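(* Let $G$ and $H$ be finite simple connected graphs, neither of which is a complete graph. Then $tn(G\boxtimes H)\le 3$.
   Context: The strong product $G\boxtimes H$ has vertex set $V(G)\times V(H)$; $(g_1,h_1)$ and $(g_2,h_2)$ are adjacent iff ($g_1g_2\in E(G)$ and $h_1=h_2$) or ($g_1=g_2$ and $h_1h_2\in E(H)$) or ($g_1g_2\in E(G)$ and $h_1h_2\in E(H)$). For two different non-adjacent vertices $u,v$ of a graph $F$, a tolled walk between $u$ and $v$ is a sequence of vertices $u,w_1,\dots,w_k,v$ with $k\ge 1$ such that consecutive vertices of $w_1,\dots,w_k$ are adjacent, $uw_i\in E(F)$ if and only if $i=1$, and $vw_i\in E(F)$ if and only if $i=k$. If $uv\in E(F)$, the only tolled walk between $u$ and $v$ is $u,v$; the only tolled walk from $v$ to itself is the single vertex $v$. The toll interval $T_F(u,v)$ is the set of all vertices of $F$ lying on some tolled walk between $u$ and $v$. For $S\subseteq V(F)$ the toll closure is $T_F[S]=\bigcup_{u,v\in S}T_F(u,v)$. $S$ is a toll set of $F$ if $T_F[S]=V(F)$, and the toll number $tn(F)$ is the minimum size of a toll set of $F$. *)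

(* Defs.v *)
From mathcomp Require Import all_boot.
From mathcomp Require Import boolp.

Set Implicit Arguments.
Unset Strict Implicit.
Unset Printing Implicit Defensive.

Record sgraph := SGraph {
  vertex :> finType;
  edge : rel vertex;
  edge_sym : symmetric edge;
  edge_irrefl : irreflexive edge
}.

Definition connected (G : sgraph) : Prop :=
  forall x y : G, connect (@edge G) x y.

Definition complete (G : sgraph) : Prop :=
  forall x y : G, x != y -> edge x y.

Section StrongProduct.
Variables G H : sgraph.

Definition strong_edge : rel (G * H) := fun p q =>
  [|| edge p.1 q.1 && (p.2 == q.2),
      (p.1 == q.1) && edge p.2 q.2
    | edge p.1 q.1 && edge p.2 q.2].

Lemma strong_edge_sym : symmetric strong_edge.
Proof.
move=> p q; rewrite /strong_edge.
by rewrite ![edge p.1 _]edge_sym ![edge p.2 _]edge_sym (eq_sym p.1) (eq_sym p.2).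
Qed.

Lemma strong_edge_irrefl : irreflexive strong_edge.
Proof. by move=> p; rewrite /strong_edge !edge_irrefl !andbF. Qed.

Definition strong_product : sgraph := SGraph strong_edge_sym strong_edge_irrefl.

End StrongProduct.

Section Toll.
Variable F : sgraph.
Implicit Types (u v x : F) (S : {set F}).

(* [s] is the whole walk, end vertices included. The inner vertices
   w_1, ..., w_k are the entries 0, ..., k-1 of [w]. *)
Definition tolled_walk u v (s : seq F) : Prop :=
  if u == v then s = [:: u]
  else if edge u v then s = [:: u; v]
  else exists w : seq F,
    [/\ s = u :: rcons w v,
        (0 < size w)%N,
        forall i, (i.+1 < size w)%N -> edge (nth u w i) (nth u w i.+1),
        forall i, (i < size w)%N -> edge u (nth u w i) = (i == 0%N)
      & forall i, (i < size w)%N -> edge v (nth u w i) = (i.+1 == size w)].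

Definition toll_interval u v : {set F} :=
  [set x | `[< exists2 s, tolled_walk u v s & x \in s >]].

Definition toll_closure S : {set F} :=
  \bigcup_(u in S) \bigcup_(v in S) toll_interval u v.

Definition toll_set S : bool := toll_closure S == [set: F].

Lemma toll_setT : toll_set [set: F].
Proof.
apply/eqP/setP => x; rewrite in_setT.
apply/bigcupP; exists x => //; apply/bigcupP; exists x => //.
rewrite inE; apply/asboolP; exists [:: x]; last by rewrite inE.
by rewrite /tolled_walk eqxx.
Qed.

Lemma toll_set_size_exists :
  exists n : nat, [exists S : {set F}, toll_set S && (#|S| == n)].
Proof. by exists #|[set: F]|; apply/existsP; exists setT; rewrite toll_setT /=. Qed.

Definition toll_number : nat := ex_minn toll_set_size_exists.

End Toll.

(* Main.v *)
Require Import Defs.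
From mathcomp Require Import all_boot.
From mathcomp Require Import boolp.

(** If the vertices outside N[u] induce a connected graph, and likewise for v,
    then for nonadjacent u, v the toll interval T(u, v) misses only vertices x
    with N[x] contained in N[u] or in N[v].  The first inclusion gives u in N[x],
    so x cannot satisfy both; hence any three pairwise nonadjacent vertices of
    this kind form a toll set.  In a strong product N[(g, h)] = N[g] x N[h],
    whose complement is a union of full fibres, and is connected as soon as
    neither g nor h is universal.  For g1, g2 and h1, h2 nonadjacent, the
    vertices (g1, h1), (g1, h2), (g2, h1) therefore form a toll set. *)

Set Implicit Arguments.
Unset Strict Implicit.
Unset Printing Implicit Defensive.

Section TollTriple.
Variable F : sgraph.
Implicit Types (u v x y : F) (p q : seq F).

Definition closed_nbr : rel F := fun x y => (x == y) || edge x y.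

Lemma closed_nbr_refl x : closed_nbr x x.
Proof. by rewrite /closed_nbr eqxx. Qed.

Lemma closed_nbr_sym : symmetric closed_nbr.
Proof. by move=> x y; rewrite /closed_nbr eq_sym edge_sym. Qed.

Definition avoids u p := all (fun y => ~~ closed_nbr u y) p.

(** Connectedness of the graph induced outside N[u]. Only the head [b] of each step is tested, as
    the start [y] is outside N[u] by assumption. *)
Definition co_connected u := forall y z, ~~ closed_nbr u y -> ~~ closed_nbr u z ->
  connect (fun a b => edge a b && ~~ closed_nbr u b) y z.

(** The start [x] may itself lie in N[u]: one step to [y], or none if [y = x], leaves N[u], and
    [co_connected] does the rest. *)
Lemma avoiding_path u x y v : co_connected u -> closed_nbr x y ->
  ~~ closed_nbr u y -> ~~ closed_nbr u v ->
  exists p, [/\ path (@edge F) x p, last x p = v & avoids u p].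
Proof.
move=> cou xy uy uv; have /connectP[p pth ->] := cou _ _ uy uv.
have [pe pa] : path (@edge F) y p /\ avoids u p.
  elim: p y pth {xy uy} => //= z p IH y /andP[/andP[yz uz] /IH[zp up]].
  by rewrite yz uz.
case/orP: xy => [/eqP->|xy]; first by exists p.
by exists (y :: p); rewrite /= xy uy.
Qed.

(** Cut the path at its first neighbour of [v]. Since [x != v], such a vertex occurs before [v] is
    reached. *)
Lemma path_until_nbr d u v x p : x != v -> path (@edge F) x p -> last x p = v ->
  avoids u p ->
  exists q, [/\ path (@edge F) x q, avoids u q &
    forall i, i < size (x :: q) -> edge v (nth d (x :: q) i) = (i.+1 == size (x :: q))].
Proof.
elim: p x => [|y p IH] x xv /=; first by move=> _ xv'; rewrite xv' eqxx in xv.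
case/andP=> xy yp lst /andP[uy up].
have [vx|vx] := boolP (edge v x); first by exists [::]; split=> // -[].
have yv : y != v by apply: contraNneq vx => <-; rewrite edge_sym.
have [q [yq uq qP]] := IH y yv yp lst up.
exists (y :: q); split; [by rewrite /= xy | by rewrite /= uy | ].
by case=> [_|i /qP]; [exact: negbTE | ].
Qed.

Lemma nbr_of_last_only d v x p q : avoids v q ->
  (forall i, i < size (x :: p) -> edge v (nth d (x :: p) i) = (i.+1 == size (x :: p))) ->
  forall i, i < size (q ++ x :: p) ->
    edge v (nth d (q ++ x :: p) i) = (i.+1 == size (q ++ x :: p)).
Proof.
move=> /allP vq vp i; rewrite size_cat nth_cat => isz.
case: (ltnP i (size q)) => iq.
  have /vq := mem_nth d iq; rewrite /closed_nbr negb_or => /andP[_ /negbTE->].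
  by rewrite /= addnS eqSS ltn_eqF // (leq_trans iq) // leq_addr.
by rewrite vp ?ltn_subLR // -(eqn_add2l (size q)) addnS subnKC.
Qed.

(** From [x], one path runs towards [v] off N[u] and another towards [u] off N[v], each cut at the
    first neighbour of its target. The second, reversed, followed by the first is the interior of a
    tolled walk through [x]. *)
Lemma mem_toll_interval u v x : co_connected u -> co_connected v ->
  ~~ closed_nbr u v -> x != u -> x != v ->
  ~ {subset closed_nbr x <= closed_nbr u} ->
  ~ {subset closed_nbr x <= closed_nbr v} ->
  x \in toll_interval u v.
Proof.
move=> cou cov uv xu xv.
have good t : ~ {subset closed_nbr x <= closed_nbr t} ->
    exists2 s, closed_nbr x s & ~~ closed_nbr t s.
  move=> nsub; apply: contra_notP nsub => no s xs; apply: contra_notT no => ts.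
  by exists s.
move=> /good[y xy uy] /good[z xz vz].
have [p [xp lp up]] := avoiding_path cou xy uy uv.
have vu : ~~ closed_nbr v u by rewrite closed_nbr_sym.
have [q [xq lq vq]] := avoiding_path cov xz vz vu.
have {xp lp up p} [p [xp up pP]] := path_until_nbr u xv xp lp up.
have {xq lq vq q} [q [xq vq qP]] := path_until_nbr u xu xq lq vq.
pose w := rev q ++ x :: p.
have rw : rev w = rev p ++ x :: q by rewrite rev_cat revK rev_cons cat_rcons.
have sw : sorted (@edge F) w.
  have eC : (fun a b => edge b a) =2 @edge F by move=> a b; exact: edge_sym.
  have: sorted (@edge F) (rev (x :: q)) by rewrite rev_sorted (eq_sorted eC).
  rewrite /w rev_cons -cats1; case: (rev q) => //= s r.
  by rewrite !cat_path /= andbT => /andP[-> ->].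
rewrite inE; apply/asboolP; exists (u :: rcons w v); last first.
  by rewrite inE mem_rcons inE mem_cat inE eqxx !orbT.
move: uv; rewrite /tolled_walk /closed_nbr negb_or => /andP[/negbTE-> /negbTE->].
exists w; split=> //.
- by rewrite size_cat /= addnS.
- by move=> i; apply/sortedP.
- move=> i isz; rewrite -[w]revK nth_rev ?size_rev // rw.
  have sw' : size w = size (rev p ++ x :: q) by rewrite -rw size_rev.
  rewrite sw' in isz *; rewrite (nbr_of_last_only _ qP) ?/avoids ?all_rev //; last first.
    by rewrite ltn_subrL (leq_ltn_trans _ isz).
  by rewrite -subSn // subSS -{2}[size _]subn0 eqn_sub2lE // ltnW.
- by apply: nbr_of_last_only => //; rewrite /avoids all_rev.
Qed.

Lemma toll_number_le3 u v t : co_connected u -> co_connected v -> co_connected t ->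
  ~~ closed_nbr u v -> ~~ closed_nbr u t -> ~~ closed_nbr v t ->
  toll_number F <= 3.
Proof.
move=> cou cov cot uv ut vt.
pose S := [set u; v; t].
suff tollS : toll_set S.
  rewrite /toll_number; case: ex_minnP => n _ /(_ #|S|) le_n.
  apply: leq_trans (le_n _) _; first by apply/existsP; exists S; rewrite tollS /=.
  by rewrite /S -setUA cardsU1 cards2; do 2 case: (_ \notin _) || case: (_ != _).
have incompat a b x : ~~ closed_nbr a b -> {subset closed_nbr x <= closed_nbr a} ->
    ~ {subset closed_nbr x <= closed_nbr b}.
  move=> /negP ab xa xb; apply: ab; rewrite closed_nbr_sym; apply: xb.
  have xa' : closed_nbr a x := xa x (closed_nbr_refl x).
  by rewrite closed_nbr_sym in xa'.
have in_closure a b x : a \in S -> b \in S -> x \in toll_interval a b ->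
    x \in toll_closure S.
  by move=> aS bS xab; apply/bigcupP; exists a => //; apply/bigcupP; exists b.
have [uS vS tS] : [/\ u \in S, v \in S & t \in S] by rewrite !inE !eqxx !orbT.
apply/eqP/setP => x; rewrite in_setT.
have [xS|] := boolP (x \in S).
  apply: (in_closure x x) => //; rewrite inE; apply/asboolP.
  by exists [:: x]; rewrite /tolled_walk ?eqxx ?inE.
rewrite !inE !negb_or -andbA => /and3P[xu xv xt].
(* If one of N[u], N[v] contains N[x], the two other vertices of the triple serve as ends; otherwise
   [u] and [v] do. *)
have [xsu|xsu] := pselect {subset closed_nbr x <= closed_nbr u}.
  by apply: (in_closure v t) => //; apply: mem_toll_interval => //; apply: incompat xsu.
have [xsv|xsv] := pselect {subset closed_nbr x <= closed_nbr v}.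
  apply: (in_closure u t) => //; apply: mem_toll_interval => //.
  exact: incompat xsv.
by apply: (in_closure u v) => //; apply: mem_toll_interval.
Qed.

End TollTriple.

Section StrongProductComplement.
Variables G H : sgraph.
Implicit Types (g a : G) (h b : H).

Lemma closed_nbr_strong (p q : strong_product G H) :
  closed_nbr p q = closed_nbr p.1 q.1 && closed_nbr p.2 q.2.
Proof.
case: p q => [g h] [a b]; rewrite /closed_nbr /= /strong_edge /= xpair_eqE.
by case: (g == a); case: (h == b); case: (edge g a); case: (edge h b).
Qed.

Lemma co_connected_strong g h a b : connected G -> connected H ->
  ~~ closed_nbr g a -> ~~ closed_nbr h b ->
  co_connected ((g, h) : strong_product G H).
Proof.
move=> cG cH ga hb.
pose e (p q : strong_product G H) := edge p q && ~~ closed_nbr ((g, h) : strong_product G H) q.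
have fibreH a' : ~~ closed_nbr g a' -> forall y z, connect e (a', y) (a', z).
  move=> ga' y z; have /connectP[p yp ->] := cH y z.
  elim: p y yp => //= y' p IH y /andP[yy' /IH]; apply: connect_trans.
  apply: connect1; rewrite /e closed_nbr_strong negb_and ga' andbT.
  by rewrite /= /strong_edge /= eqxx yy' orbT.
have fibreG b' : ~~ closed_nbr h b' -> forall y z, connect e (y, b') (z, b').
  move=> hb' y z; have /connectP[p yp ->] := cG y z.
  elim: p y yp => //= y' p IH y /andP[yy' /IH]; apply: connect_trans.
  apply: connect1; rewrite /e closed_nbr_strong negb_and hb' orbT andbT.
  by rewrite /= /strong_edge /= eqxx yy'.
move=> [y1 y2] [z1 z2]; rewrite !closed_nbr_strong !negb_and /=.
(* Fibres of different directions meet. Two parallel ones are joined by a transversal fibre, over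
   [b] or over [a]. *)
case/orP=> [gy|hy] /orP[gz|hz]; rewrite -/e.
- apply: connect_trans (fibreH _ gy y2 b) _.
  exact: connect_trans (fibreG _ hb y1 z1) (fibreH _ gz b z2).
- exact: connect_trans (fibreH _ gy y2 z2) (fibreG _ hz y1 z1).
- exact: connect_trans (fibreG _ hy y1 z1) (fibreH _ gz y2 z2).
- apply: connect_trans (fibreG _ hy y1 a) _.
  exact: connect_trans (fibreH _ ga y2 z2) (fibreG _ hz a z1).
Qed.

End StrongProductComplement.

Lemma noncomplete_nonadjacent (G : sgraph) :
  ~ complete G -> exists x y : G, ~~ closed_nbr x y.
Proof.
move=> nc; apply: contra_notP nc => no x y xy; apply: contra_notT no => nxy.
by exists x, y; rewrite negb_or xy.
Qed.

Theorem theorem4p1 (G H : sgraph)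
    (G_connected : connected G) (H_connected : connected H)
    (G_not_complete : ~ complete G) (H_not_complete : ~ complete H) :
  (toll_number (strong_product G H) <= 3)%N.
Proof.
have [g1 [g2 g12]] := noncomplete_nonadjacent G_not_complete.
have [h1 [h2 h12]] := noncomplete_nonadjacent H_not_complete.
have g21 : ~~ closed_nbr g2 g1 by rewrite closed_nbr_sym.
have h21 : ~~ closed_nbr h2 h1 by rewrite closed_nbr_sym.
apply: (@toll_number_le3 (strong_product G H) (g1, h1) (g1, h2) (g2, h1)).
(* In each coordinate, the required non-neighbour is the other vertex of the chosen pair. *)
- exact: co_connected_strong g12 h12.
- exact: co_connected_strong g12 h21.
- exact: co_connected_strong g21 h12.
- by rewrite closed_nbr_strong negb_and h12 orbT.
- by rewrite closed_nbr_strong negb_and g12.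
- by rewrite closed_nbr_strong negb_and g12.
Qed.
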